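(* Let $Z:=\{Q=(q_n)_{n\in\omega}\in\mathbb{Q}_+^{\omega} : q_n<q_{n+1}\text{ for all }n\in\omega,\ \lim_{n\to\infty}q_n=+\infty\}$, equipped with the metric $d$ given by $d(Q,Q)=0$ and, for $Q\neq Q'$, $d(Q,Q')=2^{-\min(q_k,q'_k)}$ where $k=\min\{n\in\omega : q_n\neq q'_n\}$. There exists a closed subset of $Z$ whose characteristic function (a function from $Z$ to $\{0,1\}$) is not first return recoverable.
   Context: $\mathbb{Q}_+$ is the set of nonnegative rationals. $(Z,d)$ is a separable ultrametric space. Let $(X,d)$ be a separable metric space, $D=(x_p)_{p\in\omega}$ a dense sequence in $X$ and $x\in X$. The route to $x$ based on $D$ is the sequence $(s'_n[x,D])_{n\in\omega}$ defined by: $s'_0[x,D]:=x_0$; $s'_{n+1}[x,D]:=s'_n[x,D]$ if $x=s'_n[x,D]$; otherwise $s'_{n+1}[x,D]:=x_p$ with $p$ the least integer such that $d(x,x_p)<d(x,s'_n[x,D])$. A function $f:X\to Y$ into a separable metrizable space is first return recoverable (relative to $d$) if there exists a dense sequence $D$ of $X$ such that for every $x\in X$ the sequence $(f(s'_n[x,D]))_n$ tends to $f(x)$. *)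

(* Defs.v *)
From HB Require Import structures.
From mathcomp Require Import all_boot all_order all_algebra.
From mathcomp Require Import all_classical all_reals all_analysis.

Set Implicit Arguments.
Unset Strict Implicit.
Unset Printing Implicit Defensive.

Import Order.TTheory GRing.Theory Num.Theory.
Import numFieldNormedType.Exports.

Local Open Scope classical_set_scope.
Local Open Scope ring_scope.

Section FirstReturn.
Context {R : realType} {X : metricType R}.
Implicit Types (D : nat -> X) (x y : X).

(* The least p with d(x, x_p) < d(x, y). The default value 0 is never used by
   [route] when D is dense, see [closer_exists]. *)
Definition first_closer D x y : nat :=
  if pselect (exists p : nat, mdist x (D p) < mdist x y) is left h
  then ex_minn h else 0%N.

Fixpoint route D x (n : nat) : X :=
  if n is m.+1 then
    let s := route D x m in
    if x == s then s else D (first_closer D x s)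
  else D 0%N.

Definition first_return_recoverable {Y : topologicalType} (f : X -> Y) : Prop :=
  exists D : nat -> X, dense (range D) /\
    forall x : X, f (route D x n) @[n --> \oo] --> f x.

Lemma closer_exists D x y : dense (range D) -> x != y ->
  exists p : nat, mdist x (D p) < mdist x y.
Proof.
move=> dD; rewrite -mdist_gt0 => xy.
have xball : nbhs x (ball x (mdist x y)) by exact: nbhsx_ballx.
have [] := dD (interior (ball x (mdist x y))).
- by exists x; exact: nbhs_singleton (nbhs_interior xball).
- exact: open_interior.
move=> z [/interior_subset xz [p _ Dp]]; exists p.
by move: xz; rewrite -Dp ballEmdist.
Qed.

End FirstReturn.

(* The parameter R only fixes the field in which the metric takes its values;
   it does not occur in the data. The limit is taken in the ordered field
   rat. *)
Record divseq (R : realType) := DivSeq {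
  divseq_val :> nat -> rat;
  divseq_ge0 : forall n : nat, 0 <= divseq_val n;
  divseq_lt : forall n : nat, divseq_val n < divseq_val n.+1;
  divseq_lim : divseq_val n @[n --> \oo] --> +oo }.

Section DivseqMetric.
Context {R : realType}.
Implicit Types P Q S : divseq R.

HB.instance Definition _ := gen_eqMixin (divseq R).
HB.instance Definition _ := gen_choiceMixin (divseq R).

Lemma divseq_inj P Q : (forall n, P n = Q n) -> P = Q.
Proof.
case: P Q => [p p1 p2 p3] [q q1 q2 q3] /= /funext pq.
by subst q; congr DivSeq; exact: Prop_irrelevance.
Qed.

(* If no index separates P and Q, then P = Q by [divseq_inj]. *)
Definition divseq_dist P Q : R :=
  if pselect (exists n : nat, P n != Q n) is left h
  then let k := ex_minn h in 2 `^ (- ratr (Num.min (P k) (Q k)))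
  else 0.

Lemma divseq_dist_min P Q (k : nat) : P k != Q k ->
  (forall i, (i < k)%N -> P i = Q i) ->
  divseq_dist P Q = 2 `^ (- ratr (Num.min (P k) (Q k))).
Proof.
move=> Pk ltk; rewrite /divseq_dist; case: pselect => [h|]; last first.
  by case; exists k.
case: ex_minnP => m Pm mmin /=; suff -> : m = k by [].
apply/eqP; rewrite eqn_leq mmin//= leqNgt; apply/negP => /ltk mk.
by rewrite mk eqxx in Pm.
Qed.

Lemma divseq_distP P Q : P = Q \/
  exists2 k : nat, P k != Q k & forall i, (i < k)%N -> P i = Q i.
Proof.
have [h|h] := pselect (exists n : nat, P n != Q n); last first.
  left; apply: divseq_inj => n; apply/eqP; apply/negPn/negP => Pn.
  by apply: h; exists n.
right; case: (ex_minnP h) => k Pk kmin; exists k => // i ik.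
by apply/eqP; apply/negPn/negP => /kmin; rewrite leqNgt ik.
Qed.

Lemma divseq_distxx P : divseq_dist P P = 0.
Proof.
by rewrite /divseq_dist; case: pselect => // h; exfalso; case: h => n /eqP.
Qed.

Lemma divseq_dist_ge0 P Q : 0 <= divseq_dist P Q.
Proof. by rewrite /divseq_dist; case: pselect => // h; exact: powR_ge0. Qed.

Lemma divseq_dist_eq0 P Q : divseq_dist P Q = 0 -> P = Q.
Proof.
have [//|[k Pk /(divseq_dist_min Pk) ->]] := divseq_distP P Q.
by move/eqP; rewrite gt_eqF// powR_gt0.
Qed.

Lemma divseq_dist_sym P Q : divseq_dist P Q = divseq_dist Q P.
Proof.
have [->//|[k Pk ltk]] := divseq_distP P Q.
rewrite (divseq_dist_min Pk ltk) minC (@divseq_dist_min Q P k)//.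
  by rewrite eq_sym.
by move=> i /ltk.
Qed.

Lemma divseq_mono Q (m n : nat) : (m <= n)%N -> Q m <= Q n.
Proof.
by apply: (homo_leq (fun=> lexx _) le_trans) => i; exact/ltW/divseq_lt.
Qed.

Lemma divseq_dist_le P Q (k : nat) (r : rat) :
  (forall i, (i < k)%N -> P i = Q i) -> r <= P k -> r <= Q k ->
  divseq_dist P Q <= 2 `^ (- ratr r).
Proof.
move=> ltk rP rQ; have [->|[j Pj ltj]] := divseq_distP P Q.
  by rewrite divseq_distxx powR_ge0.
rewrite (divseq_dist_min Pj ltj) ler_powR ?ler1n// lerN2 ler_rat.
have kj : (k <= j)%N.
  by rewrite leqNgt; apply/negP => /ltk PQ; rewrite PQ eqxx in Pj.
by rewrite le_min (le_trans rP) ?(le_trans rQ)// divseq_mono.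
Qed.

Lemma divseq_dist_ultra Q P S :
  divseq_dist P S <= Num.max (divseq_dist P Q) (divseq_dist Q S).
Proof.
have [<-|[k Pk ltk]] := divseq_distP P S.
  by rewrite divseq_distxx le_max divseq_dist_ge0.
have [->|[i Pi lti]] := divseq_distP P Q.
  by rewrite le_max lexx orbT.
have [<-|[j Qj ltj]] := divseq_distP Q S.
  by rewrite le_max lexx.
have cmp (r s : rat) : r <= s -> 2 `^ (- ratr s) <= 2 `^ (- ratr r) :> R.
  by move=> rs; rewrite ler_powR ?ler1n// lerN2 ler_rat.
rewrite (divseq_dist_min Pi lti) (divseq_dist_min Qj ltj) le_max.
have [ij|ji|ij] := ltngtP i j.
- apply/orP; left; apply: (@divseq_dist_le _ _ i).
  + by move=> l li; rewrite lti// ltj// (ltn_trans li).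
  + by rewrite ge_min lexx.
  + by rewrite -(ltj _ ij) ge_min lexx orbT.
- apply/orP; right; apply: (@divseq_dist_le _ _ j).
  + by move=> l lj; rewrite lti ?ltj// (ltn_trans lj).
  + by rewrite (lti _ ji) ge_min lexx.
  + by rewrite ge_min lexx orbT.
- subst j.
  set r1 := Num.min (P i) (Q i); set r2 := Num.min (Q i) (S i).
  have lt_ l : (l < i)%N -> P l = S l by move=> li; rewrite lti ?ltj.
  have [PS|/ltW SP] := leP (P i) (S i).
  + apply/orP; left; apply: (divseq_dist_le lt_); rewrite /r1 ge_min ?lexx//.
    by rewrite PS.
  + apply/orP; right; apply: (divseq_dist_le lt_); rewrite /r2 ge_min ?lexx ?orbT//.
    by rewrite SP orbT.
Qed.

Lemma divseq_dist_triangle Q P S :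
  divseq_dist P S <= divseq_dist P Q + divseq_dist Q S.
Proof.
apply: (le_trans (divseq_dist_ultra Q P S)).
by rewrite ge_max lerDl lerDr !divseq_dist_ge0.
Qed.

HB.instance Definition _ := @isMetric.Build R (divseq R) divseq_dist
  divseq_distxx divseq_dist_eq0 divseq_dist_sym divseq_dist_triangle.

Lemma mdist_divseqE P Q : mdist P Q = divseq_dist P Q.
Proof. by []. Qed.

Lemma divseq_nat_lim : (n%:R : rat) @[n --> \oo] --> +oo.
Proof.
apply/cvgryPge => A; near=> n.
apply: (le_trans (ler_norm A)); apply: (le_trans (ltW (archi_boundP (normr_ge0 A)))).
by rewrite ler_nat; near: n; exact: nbhs_infty_ge.
Unshelve. all: by end_near. Qed.

Definition divseq_nat : divseq R :=
  @DivSeq R (fun n => n%:R) (fun n => ler0n _ n)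
    (fun n => etrans (ltr_nat _ n n.+1) (ltnSn n)) divseq_nat_lim.

Lemma divseq_separable : exists D : nat -> divseq R, dense (range D).
Proof.
pose g (s : seq rat) : divseq R :=
  if pselect (exists Q : divseq R, mkseq Q (size s) = s) is left h
  then projT1 (cid h) else divseq_nat.
have gP P n i : (i < n)%N -> g (mkseq P n) i = P i.
  move=> ltin; rewrite /g; case: pselect => [h|]; last first.
    by case; exists P; rewrite size_mkseq.
  case: cid => Q /=; rewrite size_mkseq => /(congr1 (nth 0 ^~ i)).
  by rewrite !nth_mkseq.
exists (fun n => g (odflt [::] (unpickle n))) => O [P OP] oO.
have /nbhs_ballP[e /= e0 PeO] : nbhs P O by exact: open_nbhs_nbhs.
have [N PN] : exists N : nat, 2 `^ (- ratr (P N)) < e :> R.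
  pose m := (Num.bound e^-1).
  have := divseq_lim P => /cvgryPge /(_ m%:R) [N _ /(_ N (leqnn N))] /= mN.
  exists N; rewrite powRN invf_plt ?posrE ?powR_gt0//.
  apply: (lt_le_trans (archi_boundP _)); first by rewrite invr_ge0 ltW.
  apply: (@le_trans _ _ (2 `^ m%:R)).
    by rewrite powR_mulrn// -natrX ler_nat ltnW// ltn_expl.
  by rewrite ler_powR ?ler1n// -(ratr_nat R m) ler_rat.
exists (g (mkseq P N.+1)); split; last first.
  exists (pickle (mkseq P N.+1)) => //.
  have E : unpickle (pickle (mkseq P N.+1)) = Some (mkseq P N.+1).
    exact: pickleK.
  exact: (congr1 (fun o => g (odflt [::] o)) E).
apply: PeO; rewrite ballEmdist /= mdist_divseqE; apply: le_lt_trans PN.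
apply: (@divseq_dist_le _ _ N.+1).
- by move=> i iN; rewrite gP.
- exact: divseq_mono.
- by rewrite -[leLHS](@gP P N.+1)//; exact: divseq_mono.
Qed.

End DivseqMetric.

(* Main.v *)
Require Import Defs.
From HB Require Import structures.
From mathcomp Require Import all_boot all_order all_algebra.
From mathcomp Require Import all_classical all_reals all_analysis.
From mathcomp Require Import lra.

Set Implicit Arguments.
Unset Strict Implicit.
Unset Printing Implicit Defensive.

Import Order.TTheory GRing.Theory Num.Theory.
Import numFieldNormedType.Exports.

Local Open Scope classical_set_scope.
Local Open Scope ring_scope.

(* The distance from Q to Q' is 2^(-m) with m the least element of the symmetric
   difference of the sets {q_n} and {q'_n}. The closed set consists of the Q all of
   whose gaps q_(n+1) - q_n are less than 1. A finite prefix ending in m allows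
   next terms below m + 1 whose supremum m + 1 is not attained, so for a dense
   sequence D the first point of D extending the prefix with next gap at least 1
   comes after finitely many extensions with smaller gap. Choosing the next
   term of x in [m + 1/2, m + 1), above the next terms of all those, makes this
   point of D strictly closer to x than every earlier point of D, so it lies on
   the route to x. Iterating yields a point x of the closed set whose route leaves
   the set infinitely often. *)

Lemma strict_bound_below_prefix {F : realFieldType} (B : nat -> Prop)
    (v : nat -> F) (a b : F) (p : nat) : a < b ->
  (forall i, (i < p)%N -> B i -> v i < b) ->
  exists q, [/\ a <= q, q < b & forall i, (i < p)%N -> B i -> v i < q].
Proof.
move=> ab; elim: p => [|p IHp] vb; first by exists a; split.
have [i ip Bi|q [aq qb vq]] := IHp; first by apply: vb => //; exact: leqW.
have [Bp|nBp] := pselect (B p); last first.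
  exists q; split=> // i; rewrite ltnS leq_eqVlt => /predU1P[->//|ip].
  exact: vq.
have vpb := vb p (ltnSn p) Bp.
have [vpq|qvp] := ltP (v p) q.
  exists q; split=> // i; rewrite ltnS leq_eqVlt => /predU1P[->//|ip].
  exact: vq.
exists ((v p + b) / 2); split; [lra|lra|].
move=> i; rewrite ltnS leq_eqVlt => /predU1P[-> _|ip Bi]; first by lra.
by have := vq _ ip Bi; lra.
Qed.

(** The next term depends on the whole prefix, so the iteration carries the list of terms built so
    far. *)
Lemma prefix_recursion {T : Type} (a : T) (c : seq T -> T) :
  exists x : nat -> T, x 0%N = a /\ forall n, x n.+1 = c (mkseq x n.+1).
Proof.
pose s n := iter n (fun l => rcons l (c l)) [:: a].
have sS n : s n.+1 = rcons (s n) (c (s n)) by [].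
have sE n : mkseq (fun i => last a (s i)) n.+1 = s n.
  by elim: n => // n IHn; rewrite mkseqS IHn sS last_rcons.
by exists (fun n => last a (s n)); split=> // n; rewrite sE sS last_rcons.
Qed.

(** While the route sits at an index below [q], [D q] is a candidate for the next point, so the
    least closer index cannot skip [q]; since indices increase, [q] is reached. *)
Lemma record_in_route {R : realType} {X : metricType R} (D : nat -> X) (x : X)
    (q : nat) :
  (forall p, (p < q)%N -> mdist x (D q) < mdist x (D p)) ->
  exists n, route D x n = D q.
Proof.
move=> rec_q.
(* The last clause forces the next index to exceed [p]; the case [n = q] rules out the second
   alternative. *)
suff /(_ q) [//|[p [qp pq _ _]]] : forall n,
    (exists m, route D x m = D q) \/
    exists p, [/\ (n <= p)%N, (p < q)%N, route D x n = D p &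
      forall i, (i <= p)%N -> mdist x (D p) <= mdist x (D i)].
  by rewrite ltnNge qp in pq.
elim=> [|n [|[p [np pq sp rec_p]]]]; [|by left|].
  case: q rec_q => [|q] rec_q; first by left; exists 0%N.
  by right; exists 0%N; split=> // i; rewrite leqn0 => /eqP ->.
have qp : mdist x (D q) < mdist x (D p) by exact: rec_q.
have xp : x != D p by rewrite -mdist_gt0; exact: le_lt_trans (mdist_ge0 _ _) qp.
have : route D x n.+1 = D (first_closer D x (D p)).
  by rewrite /= sp (negbTE xp).
rewrite /first_closer; case: pselect => [h|[]]; last by exists q.
case: ex_minnP => r rp rmin sr.
have := rmin _ qp; rewrite leq_eqVlt => /predU1P[rq|rq].
  by left; exists n.+1; rewrite sr rq.
right; exists r; split=> //.
  rewrite (leq_ltn_trans np)// ltnNge; apply/negP => /rec_p.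
  by rewrite leNgt rp.
move=> i ir; rewrite leNgt; apply/negP => idr.
have := rmin _ (lt_trans idr rp); rewrite leqNgt ltn_neqAle ir andbT negbK.
by move=> /eqP ir'; rewrite ir' ltxx in idr.
Qed.

Section Divseq.
Context {R : realType}.
Implicit Types (P Q x : divseq R) (D : nat -> divseq R) (A : set (divseq R)).

Lemma ltr_powR2N (r s : rat) :
  (2 `^ (- ratr r) < 2 `^ (- ratr s) :> R) = (s < r).
Proof.
by rewrite /powR pnatr_eq0 ltr_expR ltr_pM2r ?ln_gt0 ?ltr1n// ltrN2 ltr_rat.
Qed.

(** A first difference at [j] gives distance at least 2^(-P j), so [P k < P j], and [P] is
    increasing. *)
Lemma mdist_lt_agree P Q (k : nat) :
  mdist P Q < 2 `^ (- ratr (P k)) -> forall i, (i <= k)%N -> P i = Q i.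
Proof.
rewrite mdist_divseqE; have [->//|[j Pj ltj]] := divseq_distP P Q.
rewrite (divseq_dist_min Pj ltj) ltr_powR2N lt_min => /andP[kj _] i ik.
apply: ltj; apply: (leq_ltn_trans ik); rewrite ltnNge; apply/negP.
by move=> /(divseq_mono P); rewrite leNgt kj.
Qed.

Lemma mdist_lt P Q (k : nat) :
  (forall i, (i < k)%N -> P i = Q i) -> P k < Q k ->
  mdist P Q = 2 `^ (- ratr (P k)).
Proof.
move=> agr PQ; rewrite mdist_divseqE (divseq_dist_min _ agr) ?lt_eqF//.
by rewrite min_l// ltW.
Qed.

(** Gaps of at least 1/2 give n/2 <= [g n], hence divergence. *)
Lemma divseq_of_gaps (g : nat -> rat) : 0 <= g 0%N ->
  (forall n, g n + 2^-1 <= g n.+1) -> exists Q, forall n, Q n = g n.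
Proof.
move=> g0 gS.
have gge n : n%:R / 2 <= g n.
  elim: n => [|n IHn]; first by rewrite mul0r.
  by rewrite -natr1 mulrDl mul1r; apply: le_trans (gS n); rewrite lerD2r.
have gpos n : 0 <= g n by apply: le_trans (gge n); rewrite divr_ge0.
have glt n : g n < g n.+1 by have := gS n; lra.
have glim : g n @[n --> \oo] --> +oo.
  apply/cvgryPge => M.
  have /cvgryPge /(_ (M * 2)) := divseq_nat_lim.
  by apply: filterS => n; have := gge n; lra.
by exists (@DivSeq R g gpos glt glim).
Qed.

Lemma divseq_shift_tail P (n : nat) :
  exists Q, forall i, Q i = P i + (n <= i)%N%:R.
Proof.
pose g i : rat := P i + (n <= i)%N%:R.
have gge i : P i <= g i by rewrite lerDl.
have gpos i : 0 <= g i by exact: le_trans (divseq_ge0 P i) (gge i).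
have glt i : g i < g i.+1.
  apply: ltr_leD; first exact: divseq_lt.
  by rewrite ler_nat; have [/leqW ->|] := leqP n i.
have glim : g i @[i --> \oo] --> +oo.
  apply/cvgryPge => M; have /cvgryPge /(_ M) := divseq_lim P.
  by apply: filterS => i /le_trans; exact.
by exists (@DivSeq R g gpos glt glim).
Qed.

Lemma dense_agree D P (k : nat) : dense (range D) ->
  exists p, forall i, (i <= k)%N -> P i = D p i.
Proof.
move=> dD; have e0 : 0 < 2 `^ (- ratr (P k)) :> R by rewrite powR_gt0.
have Pball := nbhsx_ballx P _ e0.
have [] := dD (interior (ball P (2 `^ (- ratr (P k))))).
- by exists P; exact: nbhs_singleton (nbhs_interior Pball).
- exact: open_interior.
move=> Q [/interior_subset PQ [p _ DpQ]]; exists p; rewrite DpQ.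
by apply: mdist_lt_agree; move: PQ; rewrite ballEmdist.
Qed.

Definition small_gaps : set (divseq R) :=
  [set Q : divseq R | forall n, Q n.+1 < Q n + 1].

(** Points close to [P] share its terms up to [n.+1], and the gap condition at [n] involves no
    others. *)
Lemma closed_small_gaps : closed small_gaps.
Proof.
move=> P clP n.
have e0 : 0 < 2 `^ (- ratr (P n.+1)) :> R by rewrite powR_gt0.
have [Q [QA]] := clP _ (nbhsx_ballx P _ e0).
rewrite ballEmdist /= => /mdist_lt_agree PQ.
by rewrite !PQ.
Qed.

(* [p] is the least index of a point extending [s] with next gap at least 1; the
   finitely many earlier extensions of [s] have gap less than 1, hence [q]. *)
Lemma exists_next_gap D (s : seq rat) : dense (range D) ->
  exists q, [/\ last 0 s + 2^-1 <= q, q < last 0 s + 1 &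
    forall P n, s = mkseq P n.+1 ->
    exists p, [/\ forall i, (i <= n)%N -> P i = D p i, P n + 1 <= D p n.+1 &
      forall r, (r < p)%N -> (forall i, (i <= n)%N -> P i = D r i) ->
        D r n.+1 < q]].
Proof.
move=> dD.
have [[P [n sE]]|nP] := pselect (exists P n, s = mkseq P n.+1); last first.
  (* If [s] is not a prefix of any point, the last clause is vacuous. *)
  exists (last 0 s + 2^-1); split=> //; first by lra.
  by move=> P n sE; case: nP; exists P, n.
have lastE P' m : last 0 (mkseq P' m.+1) = P' m by rewrite mkseqS last_rcons.
(* Raising the tail by 1 makes the gap after [P n] exceed 1; by density some [D p0] has this gap
   too. *)
have [Q QE] := divseq_shift_tail P n.+1.
have [p0 p0E] := dense_agree Q n.+1 dD.
pose far p := `[< (forall i, (i <= n)%N -> P i = D p i) /\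
                  P n + 1 <= D p n.+1 >].
have : exists p, far p.
  exists p0; apply/asboolP; split=> [i ni|].
    by rewrite -p0E ?leqW// QE ltnNge ni addr0.
  by rewrite -p0E// QE leqnn lerD2r ltW// divseq_lt.
move=> /ex_minnP[p /asboolP[Pp jump] pmin].
have [| r rp Pr|q [aq qb qP]] := @strict_bound_below_prefix _
    (fun r => forall i, (i <= n)%N -> P i = D r i) (fun r => D r n.+1)
    (P n + 2^-1) (P n + 1) p; first by lra.
  rewrite ltNge; apply/negP => jr.
  have : (p <= r)%N by apply: pmin; exact/asboolP.
  by rewrite leqNgt rp.
exists q; rewrite sE lastE; split=> // P' n' E.
have nn : n' = n by have := congr1 size E; rewrite !size_mkseq => -[].
have PP i : (i <= n)%N -> P' i = P i.
  move=> ni; have := congr1 (nth 0 ^~ i) E.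
  by rewrite /= !nth_mkseq// ?nn ltnS.
exists p; rewrite nn PP//; split=> // [i ni|r rp Pr].
  by rewrite PP// Pp.
by apply: qP => // i ni; rewrite -PP// Pr.
Qed.

Lemma exists_bad_point D : dense (range D) ->
  exists2 x, small_gaps x & forall n, exists p,
    [/\ forall i, (i <= n)%N -> x i = D p i, x n + 1 <= D p n.+1 &
      forall r, (r < p)%N -> mdist x (D p) < mdist x (D r)].
Proof.
move=> dD.
have [c cP] := choice (fun s => exists_next_gap s dD).
have [g [g0 gS]] := prefix_recursion (0 : rat) c.
have lastE n : last 0 (mkseq g n.+1) = g n by rewrite mkseqS last_rcons.
have gge n : g n + 2^-1 <= g n.+1.
  by rewrite gS; have [] := cP (mkseq g n.+1); rewrite lastE.
have [x xE] : exists x : divseq R, forall n, x n = g n.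
  by apply: divseq_of_gaps => //; rewrite g0.
have xA : small_gaps x.
  by move=> n; rewrite !xE gS; have [] := cP (mkseq g n.+1); rewrite lastE.
exists x => // n.
have [_ _ /(_ x n)] := cP (mkseq g n.+1).
have sE : mkseq g n.+1 = mkseq x n.+1 by apply: eq_mkseq => i; rewrite xE.
rewrite -gS -xE => /(_ sE) [p [xp jump before]]; exists p; split=> // r rp.
have xpn : mdist x (D p) = 2 `^ (- ratr (x n.+1)).
  apply: mdist_lt => //; exact: lt_le_trans (xA n) jump.
(* If [D r] were as close as [D p], it would agree with [x] up to [n]; its next term would then lie
   below [x n.+1], making it farther. *)
rewrite ltNge; apply/negP => rx; rewrite xpn in rx.
have xr : forall i, (i <= n)%N -> x i = D r i.
  apply: mdist_lt_agree; apply: (le_lt_trans rx).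
  by rewrite ltr_powR2N divseq_lt.
have rq := before _ rp xr.
move: rx; rewrite metric_sym (@mdist_lt _ _ n.+1)//.
  by rewrite leNgt ltr_powR2N rq.
by move=> i ni; rewrite xr.
Qed.

End Divseq.

Theorem theorem12 (R : realType) :
  exists A : set (divseq R),
    closed A /\ ~ first_return_recoverable (fun z : divseq R => z \in A).
Proof.
exists small_gaps; split; first exact: closed_small_gaps.
move=> [D [dD cvgD]].
have [x xA xbad] := exists_bad_point dD.
(* As [bool] is discrete, the route stays in the set from some [N] on. *)
have [N _ NA] :
    \forall n \near \oo, route D x n \in (small_gaps : set (divseq R)).
  have := cvgD x; rewrite (mem_set xA) => /(_ [set true]); apply.
  exact: discrete_set1.
(* The record point for [n] is outside the set, so the route visits it before [N]. *)
have /choice[j jP] : forall n, exists m,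
    [/\ (m < N)%N, forall i, (i <= n)%N -> x i = route D x m i &
        x n + 1 <= route D x m n.+1].
  move=> n; have [p [xp jump rec]] := xbad n.
  have [m mE] := record_in_route rec.
  exists m; rewrite mE; split=> //; rewrite ltnNge; apply/negP => /NA /=.
  by rewrite mE => /set_mem /(_ n); rewrite -(xp n)// ltNge jump.
(* The point for [n] agrees with [x] through [m.+1], so its gap at [m] is below 1, unlike that of
   the point for [m]. *)
have jinj m n : (m < n)%N -> j m = j n -> False.
  move=> mn jmn; have [_ xn _] := jP n; have [_ _ xm] := jP m.
  by move: xm; rewrite jmn -xn// leNgt xA.
have : injective (fun i : 'I_N.+1 => Ordinal (let: And3 h _ _ := jP i in h)).
  move=> a b /(congr1 val) /= ab; apply: val_inj => /=.
  by case: (ltngtP a b) => // /jinj; [case/(_ ab)|case/(_ (esym ab))].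
by move=> /leq_card; rewrite !card_ord ltnn.
Qed.
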